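(* Let $V$ be a capacity on $(\Omega,\mathcal F)$, let $n\ge2$, and let $X_1,\dots,X_n$ be real random variables on $(\Omega,\mathcal F)$. Suppose that for all bounded Borel measurable functions $\varphi_1,\dots,\varphi_n:\mathbb R\to\mathbb R$, $X_n$ is Fubini independent of $X_1,\dots,X_{n-1}$ for $\mathcal U_{\hat f}$, where $\hat f(x_1,\dots,x_n)=e^{\sum_{i=1}^n\varphi_i(x_i)}$. Then $X_n$ is exponential independent of $X_1,\dots,X_{n-1}$.
   Context: $(\Omega,\mathcal F)$ is a measurable space. A capacity is a set function $V:\mathcal F\to[0,1]$ with $V(\emptyset)=0$, $V(\Omega)=1$, and $V(A)\le V(B)$ whenever $A\subseteq B$, $A,B\in\mathcal F$. A random variable is an $\mathcal F$-measurable map $\Omega\to\mathbb R$. The Choquet integral of a bounded random variable $X$ is $$E_V[X]=\int_0^{+\infty}V(\{X\ge t\})\,dt+\int_{-\infty}^0\big[V(\{X\ge t\})-1\big]\,dt.$$ For $f:\mathbb R^n\to\mathbb R$, $\mathcal U_f=\{\{x\in\mathbb R^n: f(x)>\alpha\}:\alpha\in\mathbb R\}$. $X_n$ is Fubini independent of $X_1,\dots,X_{n-1}$ for $\mathcal U_f$ if for every $A\in\mathcal U_f$ $$V((X_1,\dots,X_n)\in A)=E_V\big[V((x_1,\dots,x_{n-1},X_n)\in A)|_{x_1=X_1,\dots,x_{n-1}=X_{n-1}}\big],$$ where the integrand is the function $\omega\mapsto h(X_1(\omega),\dots,X_{n-1}(\omega))$ with $h(x_1,\dots,x_{n-1})=V(\{\omega':(x_1,\dots,x_{n-1},X_n(\omega'))\in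 A\})$. $X_n$ is exponential independent of $X_1,\dots,X_{n-1}$ if for all bounded Borel measurable functions $\varphi_1,\dots,\varphi_n:\mathbb R\to\mathbb R$, $$E_V\big[e^{\sum_{i=1}^n\varphi_i(X_i)}\big]=E_V\big[e^{\sum_{i=1}^{n-1}\varphi_i(X_i)}\big]\cdot E_V\big[e^{\varphi_n(X_n)}\big].$$ *)

(* Defs.v *)
From mathcomp Require Import all_boot all_order all_algebra.
From mathcomp Require Import all_classical all_reals all_analysis.

Set Implicit Arguments.
Unset Strict Implicit.
Unset Printing Implicit Defensive.

Import Order.TTheory GRing.Theory Num.Theory.
Import numFieldNormedType.Exports.

Local Open Scope classical_set_scope.
Local Open Scope ring_scope.

(* A capacity is a set function on the sigma-algebra only.  It is represented
   by a total function on sets, of which nothing is required outside of the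
   measurable sets. *)
Record is_capacity (R : realType) (d : measure_display) (T : measurableType d)
    (V : set T -> R) : Prop := IsCapacity {
  capacity_ge0 : forall A, measurable A -> 0 <= V A ;
  capacity_le1 : forall A, measurable A -> V A <= 1 ;
  capacity_set0 : V set0 = 0 ;
  capacity_setT : V setT = 1 ;
  capacity_le : forall A B, measurable A -> measurable B ->
    A `<=` B -> V A <= V B
}.

(* The integrands are monotone in t, so that the Lebesgue integrals below agree
   with the (improper) Riemann ones; both are finite for X bounded and
   measurable. *)
Definition choquet (R : realType) (d : measure_display) (T : measurableType d)
    (V : set T -> R) (X : T -> R) : \bar R :=
  (\int[lebesgue_measure]_(t in `[0%R, +oo[) (V [set w | (t <= X w)%R])%:E +
   \int[lebesgue_measure]_(t in `]-oo, 0%R])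
      (V [set w | (t <= X w)%R] - 1)%:E)%E.

Definition upper_level_sets (R : realType) (n : nat) (f : 'rV[R]_n -> R) :
    set (set 'rV[R]_n) :=
  [set A | exists alpha : R, A = [set x | alpha < f x]].

(* (X_1, ..., X_n) *)
Definition joint (R : realType) (T : Type) (n : nat) (X : 'I_n -> T -> R)
    (w : T) : 'rV[R]_n :=
  \row_(i < n) X i w.

(* (x_1, ..., x_n, y) *)
Definition append_last (R : realType) (n : nat) (x : 'rV[R]_n) (y : R) :
    'rV[R]_n.+1 :=
  \row_(i < n.+1) (if unlift ord_max i is Some j then x ord0 j else y).

(* Families are indexed by 'I_n.+1: the last variable is X ord_max and the
   preceding ones are the X (lift ord_max i) for i : 'I_n. *)
Definition fubini_independent (R : realType) (d : measure_display)
    (T : measurableType d) (V : set T -> R) (n : nat) (X : 'I_n.+1 -> T -> R)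
    (U : set (set 'rV[R]_n.+1)) : Prop :=
  forall A, U A ->
    let h (x : 'rV[R]_n) := V [set w' | A (append_last x (X ord_max w'))] in
    (V [set w | A (joint X w)])%:E =
    choquet V (fun w => h (joint (fun i : 'I_n => X (lift ord_max i)) w)).

Definition exponential_independent (R : realType) (d : measure_display)
    (T : measurableType d) (V : set T -> R) (n : nat)
    (X : 'I_n.+1 -> T -> R) : Prop :=
  forall phi : 'I_n.+1 -> R -> R,
    (forall i, measurable_fun [set: R] (phi i)) ->
    (forall i, bounded_fun (phi i)) ->
    choquet V (fun w => expR (\sum_(i < n.+1) phi i (X i w))) =
    (choquet V (fun w => expR (\sum_(i < n)
        phi (lift ord_max i) (X (lift ord_max i) w))) *
     choquet V (fun w => expR (phi ord_max (X ord_max w))))%E.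

(* Main.v *)
Require Import Defs.
From mathcomp Require Import all_boot all_order all_algebra.
From mathcomp Require Import all_classical all_reals all_analysis.
From mathcomp Require Import measurable_realfun lra.

(* Write the product as [Y * Z] with [Y = exp (sum of the first n terms)] and
   put [G u = V (Z > u)]. Fubini independence reads
   [V (Y * Z > a) = int_0^oo V (s <= G (a / Y)) ds]. Since [G] is nonincreasing,
   [{u | s <= G u}] is an interval [[0, q s)] or [[0, q s]], so that
   [V (s <= G (a / Y))] is [V (q s * Y >= a)] up to the boundary. Integrating in
   [a] first gives [q s * E_V[Y]], and the integral of [q] is that of [G], i.e.
   [E_V[Z]]. The boundary is dealt with by squeezing between [a] and [c * a],
   [c > 1]: this also avoids applying Tonelli's theorem to
   [V (s <= G (a / Y))], which is only separately monotone in [a] and [s] and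
   need not be Borel measurable in the pair. *)

Set Implicit Arguments.
Unset Strict Implicit.
Unset Printing Implicit Defensive.

Import Order.TTheory GRing.Theory Num.Theory.
Import numFieldNormedType.Exports.

Local Open Scope classical_set_scope.
Local Open Scope ring_scope.

(** * Scaling of Lebesgue measure and of integrals over the half-line *)

Lemma measurable_funV_ge0 (d : measure_display) (T : measurableType d)
    (R : realType) (f : T -> R) :
  (forall x, 0 <= f x) -> measurable_fun [set: T] f ->
  measurable_fun [set: T] (fun x => (f x)^-1).
Proof.
move=> f0 mf.
(* On nonnegative reals the inverse is the power with exponent -1, also at 0. *)
have -> : (fun x => (f x)^-1) = (fun x => f x `^ (-1)).
  by apply/funext => x; rewrite powR_inv1.
exact: (measurableT_comp (measurable_powR (-1)) mf).
Qed.

Lemma lebesgue_measure_unique_mscale (R : realType) (q : {nonneg R})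
    (mu : {measure set (measurableTypeR R) -> \bar R}) :
  (forall X, ocitv X -> lebesgue_measure X = (q%:num)%:E * mu X)%E ->
  forall A, measurable A -> (lebesgue_measure A = (q%:num)%:E * mu A)%E.
Proof. exact: (@lebesgue_measure_unique R (mscale q mu)). Qed.

(** By uniqueness it suffices to compare lengths of intervals []a, b]]: the preimage []a / q, b /
    q]] has length [(b - a) / q]. *)
Lemma lebesgue_measure_scale (R : realType) (q : R) (A : set R) : 0 < q ->
  measurable A ->
  (lebesgue_measure A = q%:E * pushforward (@lebesgue_measure R)
     ((fun x => (q * x)%R) : _ -> measurableTypeR R) A)%E.
Proof.
move=> q0 mA.
have mq : measurable_fun [set: measurableTypeR R]
    ((fun x => (q * x)%R) : _ -> measurableTypeR R).
  by apply: measurable_funM => //; exact: measurable_cst.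
apply: (lebesgue_measure_unique_mscale (q := NngNum (ltW q0)))
  => //= _ [[a b]] _ <-.
rewrite /pushforward.
have -> : (fun x : R => q * x) @^-1` `]a, b] = `](a / q), (b / q)]%classic.
  by apply/seteqP; split => x /=; rewrite !in_itv /= ltr_pdivrMr//
    ler_pdivlMr// ![x * q]mulrC.
rewrite !lebesgue_measure_itv /= !lte_fin ltr_pM2r ?invr_gt0 //.
case: ifP => _; last by rewrite mule0.
by rewrite -EFinM -mulrBl mulrCA divff ?gt_eqF// mulr1.
Qed.

(** Change of variables along [x -> q * x], which maps the open half-line onto itself and pushes
    Lebesgue measure to its multiple by [q^-1]. *)
Lemma ge0_integral_scale (R : realType) (q : R) (f : R -> \bar R) : 0 < q ->
  measurable_fun [set: R] f -> (forall x, 0 <= f x)%E ->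
  (\int[lebesgue_measure]_(x in `]0%R, +oo[) f (x / q)%R =
   q%:E * \int[lebesgue_measure]_(x in `]0%R, +oo[) f x)%E.
Proof.
move=> q0 mf f0.
have mq : measurable_fun [set: measurableTypeR R]
    ((fun x => (q * x)%R) : _ -> measurableTypeR R).
  by apply: measurable_funM => //; exact: measurable_cst.
have mfq : measurable_fun [set: R] (fun x => f (x / q)).
  apply: (measurableT_comp mf).
  by apply: measurable_funM => //; exact: measurable_cst.
have -> : (\int[lebesgue_measure]_(x in `]0%R, +oo[) f x =
  \int[lebesgue_measure]_(x in (fun x : R => (q * x)%R) @^-1` `]0%R, +oo[)
    (((fun x => f (x / q)%R) \o (fun x => (q * x)%R)) x))%E.
  have -> : (fun x : R => q * x) @^-1` `]0%R, +oo[ = `]0%R, +oo[%classic.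
    by apply/seteqP; split => x /=; rewrite !in_itv /= !andbT pmulr_rgt0.
  by apply: eq_integral => x _ /=; rewrite mulrAC divff ?mul1r// gt_eqF.
rewrite -(ge0_integral_pushforward mq) //; last exact: measurable_funS mfq.
rewrite -(ge0_integral_mscale _ _ (NngNum (ltW q0)))//=;
  last exact: measurable_funS mfq.
by apply: eq_measure_integral => //= A mA _; exact: lebesgue_measure_scale.
Qed.

(* The integral of [W (c * a)] is [c^-1] times that of [W]; let [c] go to 1. *)
Lemma integral_scale_squeeze (R : realType) (W P : R -> \bar R) :
  measurable_fun [set: R] W -> measurable_fun [set: R] P ->
  (forall x, 0 <= W x)%E -> (forall x, 0 <= P x)%E ->
  (forall a : R, (0 < a)%R -> P a <= W a)%E ->
  (forall c a : R, (1 < c)%R -> (0 < a)%R -> W (c * a)%R <= P a)%E ->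
  (\int[lebesgue_measure]_(a in `]0%R, +oo[) P a =
   \int[lebesgue_measure]_(a in `]0%R, +oo[) W a)%E.
Proof.
move=> mW mP W0 P0 PW WP; apply/eqP; rewrite eq_le; apply/andP; split.
  apply: ge0_le_integral => //; try exact: measurable_funS mP;
    try exact: measurable_funS mW.
  by move=> x /=; rewrite in_itv/= andbT => /PW.
set I := (\int[_]_(_ in _) W _)%E; set J := (\int[_]_(_ in _) P _)%E.
have I0 : (0 <= I)%E by exact: integral_ge0.
have J0 : (0 <= J)%E by exact: integral_ge0.
have cIJ c : 1 < c -> (c^-1%:E * I <= J)%E.
  move=> c1; have c0 : 0 < c by exact: lt_trans c1.
  have mWc : measurable_fun [set: R] (fun x => W (x / c^-1)).
    apply: (measurableT_comp mW).
    by apply: measurable_funM => //; exact: measurable_cst.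
  rewrite /I -ge0_integral_scale ?invr_gt0//.
  apply: ge0_le_integral => //.
  - by apply: measurable_funS mWc.
  - exact: measurable_funS mP.
  - by move=> x /=; rewrite in_itv/= andbT invrK mulrC; exact: WP.
(* If [I] is infinite, any fixed [c > 1], here 2, forces [J] to be infinite too. *)
have [Ioo|Ifin] := eqVneq I +oo%E.
  have := cIJ 2 ltac:(lra); rewrite Ioo gt0_muley; first by [].
  by rewrite lte_fin invr_gt0.
have [Joo|Jfin] := eqVneq J +oo%E; first by rewrite Joo leey.
have fI : I \is a fin_num by rewrite ge0_fin_numE// ltey.
have fJ : J \is a fin_num by rewrite ge0_fin_numE// ltey.
rewrite -(fineK fI) -(fineK fJ) lee_fin.
have i0 : 0 <= fine I by exact: fine_ge0.
have j0 : 0 <= fine J by exact: fine_ge0.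
have cij c : 1 < c -> fine I <= c * fine J.
  move=> c1; have c0 : 0 < c by exact: lt_trans c1.
  have := cIJ c c1; rewrite -(fineK fI) -(fineK fJ) lee_fin.
  by rewrite mulrC ler_pdivrMr// mulrC.
apply/ler_addgt0Pr => e e0.
(* With this [c], [c * J = J + e * J / (J + 1) <= J + e]; the added 1 keeps the denominator positive
   when [J = 0]. *)
have c1 : 1 < 1 + e / (fine J + 1) by rewrite ltrDl divr_gt0//; lra.
apply: (le_trans (cij _ c1)); rewrite mulrDl mul1r lerD2l.
rewrite mulrAC ler_pdivrMr; last lra.
by rewrite ler_pM2l//; lra.
Qed.

(** * Tonelli's theorem on measurable rectangles *)

Lemma fubini_tonelli_in (d1 d2 : measure_display) (T1 : measurableType d1)
    (T2 : measurableType d2) (R : realType)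
    (m1 : {sigma_finite_measure set T1 -> \bar R})
    (m2 : {sigma_finite_measure set T2 -> \bar R})
    (D : set T1) (E : set T2) (f : T1 * T2 -> \bar R) :
  measurable D -> measurable E ->
  measurable_fun [set: T1 * T2] f -> (forall x, 0 <= f x)%E ->
  (\int[m1]_(x in D) \int[m2]_(y in E) f (x, y) =
   \int[m2]_(y in E) \int[m1]_(x in D) f (x, y))%E.
Proof.
move=> mD mE mf f0.
(* Extending [f] by zero outside [D * E] reduces the claim to the whole product space. *)
have mg : measurable_fun [set: T1 * T2] (f \_ (D `*` E)).
  apply/(measurable_restrictT _ _).1; first exact: measurableX.
  exact: measurable_funS mf.
have g0 x : (0 <= (f \_ (D `*` E)) x)%E by exact: erestrict_ge0.
have := @fubini_tonelli _ _ _ _ _ m1 m2 _ mg g0.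
have -> : (fun x => \int[m2]_y (f \_ (D `*` E)) (x, y))%E =
    (fun x => \int[m2]_(y in E) f (x, y))%E \_ D.
  apply/funext => x; rewrite patchE.
  case: ifPn => xD.
    rewrite [RHS]integral_mkcond; apply: eq_integral => y _.
    by rewrite !patchE in_setX xD.
  by apply: integral0_eq => y _; rewrite patchE in_setX (negbTE xD).
have -> : (fun y => \int[m1]_x (f \_ (D `*` E)) (x, y))%E =
    (fun y => \int[m1]_(x in D) f (x, y))%E \_ E.
  apply/funext => y; rewrite patchE.
  case: ifPn => yE.
    rewrite [RHS]integral_mkcond; apply: eq_integral => x _.
    by rewrite !patchE in_setX yE andbT.
  by apply: integral0_eq => x _; rewrite patchE in_setX (negbTE yE) andbF.
by rewrite -!integral_mkcond.
Qed.

Lemma measurable_fun_integral_in (d1 d2 : measure_display)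
    (T1 : measurableType d1) (T2 : measurableType d2) (R : realType)
    (m : {sigma_finite_measure set T2 -> \bar R})
    (E : set T2) (f : T1 * T2 -> \bar R) :
  measurable E -> measurable_fun [set: T1 * T2] f -> (forall x, 0 <= f x)%E ->
  measurable_fun [set: T1] (fun x => \int[m]_(y in E) f (x, y))%E.
Proof.
move=> mE mf f0.
have -> : (fun x => \int[m]_(y in E) f (x, y))%E =
    fubini_F m (f \_ ([set: T1] `*` E)).
  apply/funext => x; rewrite integral_mkcond; apply: eq_integral => y _.
  by rewrite !patchE in_setX in_setT.
apply: measurable_fun_fubini_tonelli_F; last by move=> x; exact: erestrict_ge0.
apply/(measurable_restrictT _ _).1; first exact: measurableX.
exact: measurable_funS mf.
Qed.

(** * Choquet integrals of nonnegative functions *)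

Section choquet_integral.
Context (R : realType) (d : measure_display) (T : measurableType d).
Context (V : set T -> R) (hV : is_capacity V).

Local Notation mu := (@lebesgue_measure R).

Let measurable_ge (X : T -> R) (t : R) : measurable_fun [set: T] X ->
  measurable [set w | t <= X w].
Proof.
move=> mX; have := mX measurableT _ (measurable_itv `[t, +oo[).
rewrite setTI; congr measurable.
by apply/seteqP; split => w /=; rewrite in_itv/= andbT.
Qed.

Let measurable_gt (X : T -> R) (t : R) : measurable_fun [set: T] X ->
  measurable [set w | t < X w].
Proof.
move=> mX; have := mX measurableT _ (measurable_itv `]t, +oo[).
rewrite setTI; congr measurable.
by apply/seteqP; split => w /=; rewrite in_itv/= andbT.
Qed.

Let V_ge_homo (X : T -> R) : measurable_fun [set: T] X ->
  {homo (fun t => V [set w | t <= X w]) : m n /~ n <= m}.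
Proof.
move=> mX m n mn; apply: (capacity_le hV); try exact: measurable_ge.
by move=> w /=; apply: le_trans.
Qed.

Let V_gt_homo (X : T -> R) : measurable_fun [set: T] X ->
  {homo (fun t => V [set w | t < X w]) : m n /~ n <= m}.
Proof.
move=> mX m n mn; apply: (capacity_le hV); try exact: measurable_gt.
by move=> w /=; apply: le_lt_trans.
Qed.

Let measurable_V_ge (X : T -> R) : measurable_fun [set: T] X ->
  measurable_fun [set: R] (fun t => (V [set w | t <= X w])%:E).
Proof.
move=> mX; apply/measurable_EFinP.
by apply: nonincreasing_measurable => //; exact: V_ge_homo.
Qed.

Let measurable_V_gt (X : T -> R) : measurable_fun [set: T] X ->
  measurable_fun [set: R] (fun t => (V [set w | t < X w])%:E).
Proof.
move=> mX; apply/measurable_EFinP.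
by apply: nonincreasing_measurable => //; exact: V_gt_homo.
Qed.

(** For [t <= 0] the set [X >= t] is the whole space, so the second integral vanishes. The endpoint
    0 is dropped to suit the scaling lemmas. *)
Lemma choquet_ge0E (X : T -> R) : measurable_fun [set: T] X ->
  (forall w, 0 <= X w) ->
  choquet V X = (\int[mu]_(t in `]0%R, +oo[) (V [set w | (t <= X w)%R])%:E)%E.
Proof.
move=> mX X0; rewrite /choquet [X in (_ + X)%E]integral0_eq ?adde0.
  rewrite -integral_itv_obnd_cbnd//.
  by apply: measurable_funS (measurable_V_ge mX).
move=> t /=; rewrite in_itv/= => t0.
suff -> : [set w | t <= X w] = setT by rewrite (capacity_setT hV) subrr.
by apply/seteqP; split => // w _ /=; exact: le_trans (X0 w).
Qed.

(** For [c > 1] and [t > 0], [X >= c * t] implies [X > t], which implies [X >= t]: the squeeze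
    applies without any continuity of [V]. *)
Lemma choquet_ge0_gtE (X : T -> R) : measurable_fun [set: T] X ->
  (forall w, 0 <= X w) ->
  choquet V X = (\int[mu]_(t in `]0%R, +oo[) (V [set w | (t < X w)%R])%:E)%E.
Proof.
move=> mX X0; rewrite choquet_ge0E//; apply/esym/integral_scale_squeeze.
- exact: measurable_V_ge.
- exact: measurable_V_gt.
- by move=> t; rewrite lee_fin (capacity_ge0 hV)//; exact: measurable_ge.
- by move=> t; rewrite lee_fin (capacity_ge0 hV)//; exact: measurable_gt.
- move=> t _; rewrite lee_fin; apply: (capacity_le hV).
  + exact: measurable_gt.
  + exact: measurable_ge.
  + by move=> w /= /ltW.
- move=> c t c1 t0; rewrite lee_fin; apply: (capacity_le hV).
  + exact: measurable_ge.
  + exact: measurable_gt.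
  + by move=> w /=; apply: lt_le_trans; rewrite ltr_pMl.
Qed.

Lemma choquet_cst_ge0 (c : R) : 0 <= c -> choquet V (fun=> c) = c%:E.
Proof.
move=> c0; rewrite choquet_ge0E//.
(* For [t > 0], [V (c >= t)] is 1 if [t <= c] and 0 otherwise. *)
transitivity (\int[mu]_(t in `]0%R, +oo[)
  (\1_(`]0%R, c]%classic : set R) t)%:E)%E; last first.
  rewrite integral_indic//= setIidl; last first.
    by move=> x /=; rewrite !in_itv/= => /andP[->].
  rewrite lebesgue_measure_itv/= lte_fin; case: ifPn => [_|].
    by rewrite sube0.
  by rewrite -leNgt => ?; congr EFin; apply/eqP; rewrite eq_le c0.
apply: eq_integral => t; rewrite inE/= in_itv/= andbT => t0; congr EFin.
rewrite indicE; have [tc|ct] := leP t c.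
  rewrite mem_set; last by rewrite /= in_itv/= t0.
  transitivity (V setT); last exact: (capacity_setT hV).
  by congr V; apply/seteqP; split.
rewrite memNset; last by rewrite /= in_itv/= t0 leNgt ct.
transitivity (V set0); last exact: (capacity_set0 hV).
by congr V; apply/seteqP; split => //= w; rewrite leNgt ct.
Qed.

(** * Generalized inverses and the product formula *)

(** For [s > 0], the conditions on [q] make the set of [u > 0] with [s <= G u] an interval from 0 to
    [q s], with its right end in or out. The lemma serves twice: for the product [Y * Z], and with
    [Y = 1] to compute the integral of [q]. *)
Lemma choquet_mixture (Y : T -> R) (G P q : R -> R) :
  measurable_fun [set: T] Y -> (forall w, 0 < Y w) ->
  {homo G : x y /~ y <= x} -> (forall u, 0 <= G u) ->
  {homo q : x y /~ y <= x} -> (forall s, 0 <= q s) ->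
  (forall s u, 0 < s -> 0 < u -> s <= G u -> u <= q s) ->
  (forall s u, 0 < s -> 0 < u -> u < q s -> s <= G u) ->
  measurable_fun [set: R] P -> (forall a, 0 <= P a) ->
  (forall a, 0 < a -> (P a)%:E = choquet V (fun w => G (a / Y w))) ->
  (\int[mu]_(a in `]0%R, +oo[) (P a)%:E =
   \int[mu]_(s in `]0%R, +oo[) (q s)%:E * choquet V Y)%E.
Proof.
move=> mY Y0 hG G0 hq q0 Gq qG mP P0 PE.
pose H t := V [set w | t <= Y w].
have mH : measurable_fun [set: R] (EFin \o H) by exact: measurable_V_ge.
have H0 t : 0 <= H t by apply: (capacity_ge0 hV); exact: measurable_ge.
have mq : measurable_fun [set: R] q by exact: nonincreasing_measurable.
have mG : measurable_fun [set: R] G by exact: nonincreasing_measurable.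
have mV : measurable_fun [set: T] (fun w => (Y w)^-1).
  by apply: measurable_funV_ge0 => // w; exact: ltW.
have mGY a : measurable_fun [set: T] (fun w => G (a / Y w)).
  apply: (measurableT_comp mG).
  by apply: measurable_funM => //; exact: measurable_cst.
(* [U (a, s)] stands for [V (q s * Y >= a)]. As a monotone function of a measurable quotient it is
   jointly measurable. The case [q s = 0] is set apart, since division by 0 yields 0 and [H 0 = 1]
   would be the wrong value. *)
pose U (z : R * R) : \bar R :=
  if 0 < q z.2 then (H (z.1 / q z.2))%:E else 0%:E.
have mU : measurable_fun [set: R * R] U.
  have mq2 : measurable_fun [set: R * R] (fun z => q z.2).
    exact: (measurableT_comp mq measurable_snd).
  apply: measurable_fun_ifT.
  - by apply: measurable_fun_ltr => //; exact: measurable_cst.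
  - apply: (measurableT_comp mH); apply: measurable_funM.
      exact: measurable_fst.
    by apply: measurable_funV_ge0.
  - exact: measurable_cst.
have U0 z : (0 <= U z)%E by rewrite /U; case: ifP; rewrite lee_fin.
pose W a := (\int[mu]_(s in `]0%R, +oo[) U (a, s))%E.
have mUs a : measurable_fun [set: R] (fun s => U (a, s)).
  exact: (measurableT_comp mU (measurable_pair1 _)).
have mUa s : measurable_fun [set: R] (fun a => U (a, s)).
  exact: (measurableT_comp mU (measurable_pair2 _)).
have PF a : 0 < a ->
    (P a)%:E = (\int[mu]_(s in `]0%R, +oo[)
      (V [set w | s <= G (a / Y w)])%:E)%E.
  by move=> a0; rewrite PE// choquet_ge0E.
(* Once [P] is replaced by [W], Tonelli's theorem applies to [U]: at fixed [s], scaling turns the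
   integral of [H (a / q s)] in [a] into [q s * E_V[Y]]. *)
rewrite (@integral_scale_squeeze _ W (EFin \o P)).
- rewrite (fubini_tonelli_in mu mu (f := U))//; try exact: measurable_itv.
  rewrite -ge0_integralZr//.
  + apply: eq_integral => s; rewrite inE/= in_itv/= andbT => s0.
    have [qs0|qs0] := ltP 0 (q s).
      under eq_integral do rewrite /U/= qs0.
      by rewrite (ge0_integral_scale qs0 mH)//= choquet_ge0E// => w; exact: ltW.
    have -> : q s = 0 by apply/eqP; rewrite eq_le qs0 q0.
    rewrite mul0e; apply: integral0_eq => a _.
    by rewrite /U/= ltNge qs0.
  + by apply: measurable_funS (measurableT_comp _ mq).
  + by move=> s _; rewrite lee_fin.
  + rewrite choquet_ge0E//.
      by apply: integral_ge0 => t _; rewrite lee_fin H0.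
    by move=> w; exact: ltW.
- exact: measurable_fun_integral_in.
- exact: measurableT_comp.
- by move=> a; exact: integral_ge0.
- by move=> a /=; rewrite lee_fin.
(* [P a <= W a]: [s <= G (a / Y)] gives [a / Y <= q s], hence [a / q s <= Y]; if [q s = 0] this is
   impossible, as [a / Y > 0]. *)
- move=> a a0; rewrite /= PF//; apply: ge0_le_integral => //.
  + by move=> s _; rewrite lee_fin; apply: (capacity_ge0 hV);
      exact: measurable_ge.
  + exact: measurable_funS (measurable_V_ge (mGY a)).
  + exact: measurable_funS (mUs a).
  + move=> s /=; rewrite in_itv/= andbT => s0; rewrite /U/=.
    case: ifPn => qs0.
      rewrite lee_fin; apply: (capacity_le hV); try exact: measurable_ge.
      move=> w /= sG; rewrite ler_pdivrMr// mulrC -ler_pdivrMr//.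
      by apply: Gq => //; rewrite divr_gt0.
    rewrite lee_fin -(capacity_set0 hV).
    apply: (capacity_le hV) => //; first exact: measurable_ge.
    move=> w /= sG; move: qs0; rewrite -leNgt => qs0.
    have aY : 0 < a / Y w by rewrite divr_gt0.
    by have := lt_le_trans aY (le_trans (Gq _ _ s0 aY sG) qs0); rewrite ltxx.
(* [W (c * a) <= P a]: [c * a <= q s * Y] with [c > 1] gives the strict bound [a / Y < q s] that
   [qG] requires. *)
- move=> c a c1 a0; rewrite /= PF//; apply: ge0_le_integral => //.
  + exact: measurable_funS (mUs _).
  + exact: measurable_funS (measurable_V_ge (mGY a)).
  + move=> s /=; rewrite in_itv/= andbT => s0; rewrite /U/=.
    case: ifPn => qs0; last first.
      by rewrite lee_fin; apply: (capacity_ge0 hV); exact: measurable_ge.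
    rewrite lee_fin; apply: (capacity_le hV); try exact: measurable_ge.
    move=> w /=; rewrite ler_pdivrMr// => caY.
    apply: qG => //; first by rewrite divr_gt0.
    by rewrite ltr_pdivrMr// [q s * _]mulrC;
      apply: lt_le_trans caY; rewrite ltr_pMl.
Qed.

Lemma nonincreasing_generalized_inverse (G : R -> R) (M : R) :
  0 <= M -> {homo G : x y /~ y <= x} -> (forall u, M < u -> G u <= 0) ->
  exists q : R -> R, [/\ {homo q : x y /~ y <= x}, forall s, 0 <= q s,
    forall s u, 0 < s -> 0 < u -> s <= G u -> u <= q s &
    forall s u, 0 < s -> 0 < u -> u < q s -> s <= G u].
Proof.
move=> M0 hG GM.
(* The inverse is the supremum of [A s]. The point 0 makes the set nonempty and the supremum
   nonnegative; the cap [M] bounds it for every [s], and excludes nothing when [s > 0], since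
   [G <= 0] beyond [M]. *)
pose A s := [set u | u = 0 \/ [/\ 0 < u, u <= M & s <= G u]].
have A0 s : A s 0 by left.
have ubA s : ubound (A s) M by move=> u [->|[]].
have hsA s : has_sup (A s) by split; [exists 0|exists M].
exists (fun s => sup (A s)); split.
- move=> x y xy; apply: ge_sup; first by exists 0.
  move=> u Au; apply: (ub_le_sup (hsA _).2).
  case: Au => [->|[u0 uM xu]]; first by left.
  by right; split => //; exact: le_trans xu.
- by move=> s; exact: (ub_le_sup (hsA _).2).
- move=> s u s0 u0 su; apply: (ub_le_sup (hsA _).2); right; split => //.
  by rewrite leNgt; apply/negP => /GM; rewrite leNgt (lt_le_trans s0 su).
(* Some [v] in [A s] exceeds [u > 0], hence is not the added 0, and [s <= G v <= G u]. *)
- move=> s u s0 u0 uq; have [v [v0|[_ _ sv]] uv] := sup_gt (hsA s).1 uq.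
    by move: uv; rewrite v0 ltNge (ltW u0).
  by apply: le_trans sv _; apply: hG; exact: ltW.
Qed.

Lemma choquet_mul (Y Z : T -> R) (M : R) :
  measurable_fun [set: T] Y -> measurable_fun [set: T] Z ->
  (forall w, 0 < Y w) -> (forall w, 0 < Z w) -> (forall w, Z w <= M) ->
  (forall a, 0 < a -> (V [set w | a < Y w * Z w])%:E =
    choquet V (fun w => V [set w' | a < Y w * Z w'])) ->
  (choquet V (fun w => Y w * Z w)%R = choquet V Y * choquet V Z)%E.
Proof.
move=> mY mZ Y0 Z0 ZM YZ.
pose G u := V [set w | u < Z w].
have hG : {homo G : x y /~ y <= x} by exact: V_gt_homo.
have G0 u : 0 <= G u by apply: (capacity_ge0 hV); exact: measurable_gt.
have mG : measurable_fun [set: R] G by exact: nonincreasing_measurable.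
(* The maximum with 0 provides the nonnegative bound that the generalized inverse asks for. *)
have GM u : Num.max 0 M < u -> G u <= 0.
  rewrite gt_max => /andP[_ Mu].
  rewrite -(capacity_set0 hV); apply: (capacity_le hV) => //.
    exact: measurable_gt.
  by move=> w /= /(lt_trans Mu); rewrite ltNge ZM.
have [|q [hq q0 Gq qG]] := nonincreasing_generalized_inverse _ hG GM.
  by rewrite le_max lexx.
have mYZ : measurable_fun [set: T] (fun w => Y w * Z w).
  exact: measurable_funM.
have qE : (\int[mu]_(s in `]0%R, +oo[) (q s)%:E = choquet V Z)%E.
  rewrite [RHS]choquet_ge0_gtE// => [|w]; last exact: ltW.
  (* With [Y = 1] the mixture identity reads [G a = E_V[G a]], the Choquet integral of a
     constant. *)
  rewrite (@choquet_mixture (fun=> 1) G G q)//.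
    by rewrite choquet_cst_ge0// mule1.
  by move=> a _; under eq_fun do rewrite divr1; rewrite choquet_cst_ge0.
rewrite [LHS]choquet_ge0_gtE// => [|w]; last by rewrite mulr_ge0// ltW.
rewrite (@choquet_mixture Y G (fun a => V [set w | a < Y w * Z w]) q)//.
- by rewrite qE muleC.
- by apply: nonincreasing_measurable => //; exact: V_gt_homo.
- by move=> a; apply: (capacity_ge0 hV); exact: measurable_gt.
(* The section [a < Y w * Z w'] is [a / Y w < Z w'], of capacity [G (a / Y w)]. *)
- move=> a a0; rewrite YZ//; congr choquet; apply/funext => w.
  congr V; apply/seteqP; split => w' /=; by rewrite ltr_pdivrMr// mulrC.
Qed.

End choquet_integral.

(** * From Fubini independence to exponential independence *)

Theorem theorem3p1 (R : realType) (d : measure_display) (T : measurableType d)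
  (V : set T -> R) (hV : is_capacity V)
  (n : nat) (hn : (2 <= n.+1)%N)
  (X : 'I_n.+1 -> T -> R) (hX : forall i, measurable_fun [set: T] (X i))
  (hF : forall phi : 'I_n.+1 -> R -> R,
    (forall i, measurable_fun [set: R] (phi i)) ->
    (forall i, bounded_fun (phi i)) ->
    fubini_independent V X
      (upper_level_sets (fun x : 'rV[R]_n.+1 =>
        expR (\sum_(i < n.+1) phi i (x ord0 i))))) :
  exponential_independent V X.
Proof.
move=> phi mphi bphi.
have mpX i : measurable_fun [set: T] (fun w => phi i (X i w)).
  exact: (measurableT_comp (mphi i) (hX i)).
have expE (x : 'I_n.+1 -> R) : expR (\sum_(i < n.+1) x i) =
    expR (\sum_(i < n) x (lift ord_max i)) * expR (x ord_max).
  rewrite big_ord_recr/= expRD; congr (expR _ * _).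
  by apply: eq_bigr => i _; congr x; apply: val_inj; exact/esym/lift_max.
under [X in choquet V X = _]eq_fun do rewrite expE.
have [M phiM] : exists M, forall r, phi ord_max r <= M.
  have [M [_ hM]] := bphi ord_max.
  (* Boundedness is stated as a bound by every number above [M], whence [M + 1]. *)
  exists (M + 1) => r; apply: le_trans (ler_norm _) _.
  by apply: (hM (M + 1)) => //; rewrite ltrDl.
apply: (choquet_mul hV (M := expR M)) => //.
- apply: (measurableT_comp (@measurable_expR R)).
  exact: measurable_sum.
- exact: (measurableT_comp (@measurable_expR R)).
- by move=> w; exact: expR_gt0.
- by move=> w; exact: expR_gt0.
- by move=> w; rewrite ler_expR.
move=> a _.
(* Fubini independence is taken at the upper level set of height [a]; the rest matches the row
   vectors with the factors [Y] and [Z]. *)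
have := hF phi mphi bphi _ (ex_intro _ a erefl).
rewrite /fubini_independent /=.
have -> : [set w | [set x : 'rV[R]_n.+1 |
    a < expR (\sum_(i < n.+1) phi i (x ord0 i))] (joint X w)] =
  [set w | a < expR (\sum_(i < n) phi (lift ord_max i) (X (lift ord_max i) w)) *
      expR (phi ord_max (X ord_max w))].
  by apply/funext => w /=; under eq_bigr do rewrite mxE; rewrite expE.
move=> ->; congr choquet; apply/funext => w; congr V.
apply/funext => w' /=.
rewrite (expE (fun i => phi i (append_last _ _ ord0 i))) mxE unlift_none.
congr (is_true (_ < expR _ * _)); apply: eq_bigr => i _.
by rewrite mxE liftK mxE.
Qed.
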